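(* Let $(X,d)$ be a compact metric space containing at least two points, let $\{f_n\}_{n\in\mathbb{N}}$ be a sequence of continuous maps $f_n:X\to X$, and suppose that $\{f_n\}$ is orbitally convergent to $f:X\to X$. Then $f$ has mean ergodic shadowing if and only if $$\bigcup_{m\ge 1}\ \bigcap_{n\ge m} MESh(f_n,x,\epsilon)\neq\emptyset$$ for all $x\in X$ and for every $\epsilon>0$.
   Context: $\mathbb{N}$ denotes the set of non-negative integers. A set $E\subset\mathbb{N}$ has density zero if $\lim_{n\to\infty}\frac{1}{n}\#(E\cap\{0,1,\dots,n-1\})=0$. Orbital convergence: $\{f_n\}_{n\in\mathbb{N}}$ is orbitally convergent to $f:X\to X$ if for every $\epsilon>0$ there is a natural number $N$ such that $d(f_n^k(x),f^k(x))<\epsilon$ for all $n\ge N$, all $x\in X$ and all $k\in\mathbb{N}$. (This implies uniform convergence, so the limit $f$ is continuous.) Let $g:X\to X$ be continuous. A sequence $\{x_i\}_{i\in\mathbb{N}}$ in $X$ is a $\delta$-ergodic pseudo orbit for $g$ if the set $\{i\in\mathbb{N}: d(g(x_i),x_{i+1})\ge\delta\}$ has density zero; it is through $x$ if $x_0=x$. It is $\epsilon$-shadowed in average (with respect to $g$) by $y\in X$ if $\limsup_{n\to\infty}\frac1n\sum_{i=0}^{n-1}d(g^i(y),x_i)<\epsilon$. The map $g$ has mean ergodic shadowing if for every $\epsilon>0$ there is $\delta>0$ such that every $\delta$-ergodic pseudo orbit for $g$ is $\epsilon$-shadowed in average by some point of $X$. For $x\in X$ and $\epsilon>0$, $MESh(g,x,\epsilon)$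 denotes the set of all $\delta>0$ such that every $\delta$-ergodic pseudo orbit for $g$ through $x$ is $\epsilon$-shadowed in average (with respect to $g$) by some point of $X$. *)

(* Defs.v *)
From mathcomp Require Import all_boot all_order all_algebra.
From mathcomp Require Import all_classical all_reals all_analysis.
Set Implicit Arguments.
Unset Strict Implicit.
Unset Printing Implicit Defensive.
Import Order.TTheory GRing.Theory Num.Theory.
Import numFieldNormedType.Exports.
Local Open Scope classical_set_scope.
Local Open Scope ring_scope.

Definition density_zero (R : realType) (E : set nat) : Prop :=
  (fun n : nat => #|[pred i : 'I_n | (i : nat) \in E]|%:R / n%:R : R)
    @ \oo --> (0 : R).

Definition orbitally_convergent (R : realType) (X : metricType R)
    (f_ : nat -> X -> X) (f : X -> X) : Prop :=
  forall eps : R, 0 < eps ->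
    exists N : nat, forall n : nat, (N <= n)%N ->
      forall (x : X) (k : nat), mdist (iter k (f_ n) x) (iter k f x) < eps.

Definition ergodic_pseudo_orbit (R : realType) (X : metricType R)
    (g : X -> X) (delta : R) (u : nat -> X) : Prop :=
  density_zero R [set i : nat | delta <= mdist (g (u i)) (u i.+1)].

(* The limit superior is taken in \bar R, where it always exists. *)
Definition shadowed_in_average (R : realType) (X : metricType R)
    (g : X -> X) (eps : R) (u : nat -> X) (y : X) : Prop :=
  (limn_esup (fun n : nat =>
     ((\sum_(0 <= i < n) mdist (iter i g y) (u i)) / n%:R)%:E) < eps%:E)%E.

Definition mean_ergodic_shadowing (R : realType) (X : metricType R)
    (g : X -> X) : Prop :=
  forall eps : R, 0 < eps -> exists2 delta : R, 0 < delta &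
    forall u : nat -> X, ergodic_pseudo_orbit g delta u ->
      exists y : X, shadowed_in_average g eps u y.

Definition MESh (R : realType) (X : metricType R)
    (g : X -> X) (x : X) (eps : R) : set R :=
  [set delta : R | 0 < delta /\
    forall u : nat -> X, ergodic_pseudo_orbit g delta u -> u 0%N = x ->
      exists y : X, shadowed_in_average g eps u y].

(* Main.v *)
Require Import Defs.
From mathcomp Require Import all_boot all_order all_algebra.
From mathcomp Require Import all_classical all_reals all_analysis.
From mathcomp Require Import lra.
Import Order.TTheory GRing.Theory Num.Theory.
Import numFieldNormedType.Exports.
Local Open Scope classical_set_scope.
Local Open Scope ring_scope.

(** Suppose that all iterates of [g] and [h] stay within [c] of each other,
    uniformly in the point and in the number of iterations.  Then every
    [delta]-ergodic pseudo orbit of [g] is a [(delta + c)]-ergodic one of [h]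
    ([ergodic_pseudo_orbit_transfer]), and replacing [g] by [h] changes the
    average distance of an orbit to a given sequence by at most [c]
    ([shadowed_in_average_transfer]).  Orbital convergence provides such a [c],
    as small as desired, for [f] and every [f_ n] with [n] large, so that
    shadowing passes between them, in both directions, at the cost of halving
    [delta] and [eps]; the [delta] so obtained does not depend on [n].

    The right-hand side of the equivalence, however, lets [delta] depend on the
    base point [x], whereas mean ergodic shadowing asks for a single [delta].
    No uniformity in [x] has to be extracted: both density zero and averages
    ignore finitely many indices, so the first term of any pseudo orbit may be
    replaced by one arbitrary point [x0] fixed in advance, and the [delta]
    attached to [x0] serves all pseudo orbits.  Both transfer lemmas are
    therefore stated for a pair of sequences that agree from some index on. *)

Lemma cvg_divn (R : realType) (K : R) :
  (fun n : nat => K / n%:R) @ \oo --> (0 : R).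
Proof.
rewrite -[0](mulr0 K) -cvg_shiftS /=.
exact: cvgM (cvg_cst K) cvg_harmonic.
Qed.

Lemma card_ord_lt_le (n N : nat) : (#|[pred i : 'I_n | (i < N)%N]| <= N)%N.
Proof.
rewrite cardE -(size_map val) -[leqRHS](size_iota 0).
apply: uniq_leq_size; first by rewrite (map_inj_uniq val_inj) enum_uniq.
by move=> _ /mapP[i + ->]; rewrite mem_enum mem_iota.
Qed.

(** Finitely many indices contribute at most [N / n] to the frequency. *)
Lemma density_zero_sub (R : realType) (E F : set nat) (N : nat) :
  (forall i, (N <= i)%N -> F i -> E i) ->
  density_zero R E -> density_zero R F.
Proof.
move=> FE E0.
have card_le n : (#|[pred i : 'I_n | (i : nat) \in F]| <=
    #|[pred i : 'I_n | (i : nat) \in E]| + N)%N.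
  apply: leq_trans (leq_add (leqnn _) (card_ord_lt_le n N)).
  rewrite -cardUI; apply: leq_trans (leq_addr _ _).
  apply: subset_leq_card; apply/fintype.subsetP => i; rewrite !inE => Fi.
  by case: ltnP => [//|Ni]; rewrite ?orbT// orbF; apply/mem_set/FE => //;
    exact: set_mem.
have freq_ub : (fun n => #|[pred i : 'I_n | (i : nat) \in E]|%:R / n%:R +
    N%:R / n%:R : R) @ \oo --> (0 : R).
  by rewrite -[X in _ --> X]addr0; exact: cvgD E0 (cvg_divn _ _).
apply: (squeeze_cvgr _ (cvg_cst (0 : R)) freq_ub); apply: nearW => n.
rewrite divr_ge0//= -mulrDl ler_wpM2r ?invr_ge0//.
by rewrite -natrD ler_nat card_le.
Qed.

(** Strict bounds on a limit superior leave room: they are witnessed by a real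
    [r < e] that bounds the sequence eventually. *)
Lemma limn_esup_ltP (R : realType) (a : nat -> R) (e : R) :
  (limn_esup (fun n => (a n)%:E) < e%:E)%E <->
  exists2 r, r < e & \forall n \near \oo, a n <= r.
Proof.
split.
- move=> /ereal_inf_lt[_ [A A_oo <-] supA_lt].
  have [r supA_le re] :
      exists2 r : R, (ereal_sup [set (a n)%:E | n in A] <= r%:E)%E & r < e.
    move: (ereal_sup _) supA_lt => [s| |]//; first by exists s.
    by exists (e - 1); rewrite ?leNye// gtrBl.
  exists r => //; apply: filterS A_oo => n An.
  rewrite -lee_fin; apply: le_trans supA_le.
  by apply: ereal_sup_ubound; exists n.
- move=> [r re ar]; apply: (@le_lt_trans _ _ r%:E); last by rewrite lte_fin.
  apply: ge_ereal_inf.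
  exists (ereal_sup [set (a n)%:E | n in [set n | a n <= r]]).
    by exists [set n | a n <= r].
  by apply: ge_ereal_sup => _ [n /= anr <-]; rewrite lee_fin.
Qed.

Lemma sumr_stationary_le (R : realType) (t : nat -> R) (N n : nat) :
  (forall i, 0 <= t i) -> (forall i, (N <= i)%N -> t i = 0) ->
  \sum_(0 <= i < n) t i <= \sum_(0 <= i < N) t i.
Proof.
move=> t_ge0 t0; have [nN|Nn] := leqP n N.
  by rewrite (big_cat_nat _ nN)//= lerDl sumr_ge0.
rewrite (big_cat_nat _ (ltnW Nn))//= gerDl big_nat big1// => i /andP[Ni _].
exact: t0.
Qed.

(** At all indices [i >= N] the one-step error of [v] for [h] exceeds that of
    [u] for [g] by less than [c]. *)
Lemma ergodic_pseudo_orbit_transfer (R : realType) (X : metricType R)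
    (g h : X -> X) (delta c : R) (u v : nat -> X) (N : nat) :
  (forall x, mdist (g x) (h x) < c) ->
  (forall i, (N <= i)%N -> u i = v i) ->
  ergodic_pseudo_orbit g delta u -> ergodic_pseudo_orbit h (delta + c) v.
Proof.
move=> gh uv; apply: (@density_zero_sub _ _ _ N) => i Ni /=.
rewrite -!uv//; last exact: leqW.
have := metric_triangle (h (u i)) (g (u i)) (u i.+1).
by have := gh (u i); rewrite (metric_sym (g _) (h _)); lra.
Qed.

(** The constant [K] collects the distances between [u] and [v]; it is finite
    because they agree from [N] on, and so [K / n] tends to zero. *)
Lemma shadowed_in_average_transfer (R : realType) (X : metricType R)
    (g h : X -> X) (eps c : R) (u v : nat -> X) (N : nat) (y : X) :
  (forall x k, mdist (iter k g x) (iter k h x) < c) ->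
  (forall i, (N <= i)%N -> u i = v i) ->
  shadowed_in_average g eps u y -> shadowed_in_average h (eps + c) v y.
Proof.
move=> gh uv /limn_esup_ltP[r r_eps avg_le].
set K := \sum_(0 <= i < N) mdist (u i) (v i).
apply/limn_esup_ltP; exists ((r + eps) / 2 + c); first lra.
(* the gap between r and eps absorbs K / n *)
have gap : 0 < (eps - r) / 2 by lra.
have K_small := cvgr_le 0 (cvg_divn _ K) _ gap.
near=> n; have n_gt0 : (0 : R) < n%:R.
  by rewrite ltr0n; near: n; exact: nbhs_infty_gt.
have avg_n : (\sum_(0 <= i < n) mdist (iter i g y) (u i)) / n%:R <= r.
  by near: n; exact: avg_le.
have K_n : K / n%:R <= (eps - r) / 2 by near: n; exact: K_small.
have sum_le : \sum_(0 <= i < n) mdist (iter i h y) (v i) <=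
    \sum_(0 <= i < n) mdist (iter i g y) (u i) + c * n%:R + K.
  have K_ge : \sum_(0 <= i < n) mdist (u i) (v i) <= K.
    apply: sumr_stationary_le => [i|i /uv->]; first exact: mdist_ge0.
    exact: mdistxx.
  apply: le_trans (lerD (lexx _) K_ge).
  rewrite mulr_natr -[n in c *+ n]subn0 -sumr_const_nat -!big_split/=.
  apply: ler_sum => i _.
  have := metric_triangle (iter i h y) (iter i g y) (v i).
  have := metric_triangle (iter i g y) (u i) (v i).
  by have := gh y i; rewrite (metric_sym (iter i g y) (iter i h y)); lra.
have -> : (r + eps) / 2 + c = r + c + (eps - r) / 2 by lra.
apply: le_trans (lerD (lerD avg_n (lexx c)) K_n).
rewrite -[X in _ + X + _](mulfK (lt0r_neq0 n_gt0)) -!mulrDl.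
by rewrite ler_wpM2r ?invr_ge0// ltW.
Unshelve. all: by end_near. Qed.

Theorem theorem4p2 (R : realType) (X : metricType R)
    (X_compact : compact [set: X])
    (X_two_points : exists a b : X, a <> b)
    (f_ : nat -> X -> X) (f_continuous : forall n : nat, continuous (f_ n))
    (f : X -> X) (f_orbital : orbitally_convergent f_ f) :
  mean_ergodic_shadowing f <->
  (forall (x : X) (eps : R), 0 < eps ->
     \bigcup_(m in [set m : nat | (1 <= m)%N])
       \bigcap_(n in [set n : nat | (m <= n)%N]) MESh (f_ n) x eps !=set0).
Proof.
have half_gt0 (e : R) : 0 < e -> 0 < e / 2 by move=> *; lra.
split.
- move=> f_shadow x eps eps_gt0.
  have [delta delta_gt0 shadow] := f_shadow _ (half_gt0 _ eps_gt0).
  have [N1 close1] := f_orbital _ (half_gt0 _ delta_gt0).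
  have [N2 close2] := f_orbital _ (half_gt0 _ eps_gt0).
  exists (delta / 2); exists (maxn 1 (maxn N1 N2)); first exact: leq_maxl.
  move=> n /=; rewrite !geq_max => /and3P[_ N1n N2n].
  split=> [|u u_po _]; first exact: half_gt0.
  have [|y y_shadow] := shadow u.
    rewrite (splitr delta).
    apply: (@ergodic_pseudo_orbit_transfer _ _ _ _ _ _ u u 0 _ _ u_po) => // z.
    exact: close1 N1n z 1%N.
  exists y; rewrite (splitr eps).
  apply: (@shadowed_in_average_transfer _ _ _ _ _ _ u u 0 y _ _ y_shadow) => //.
  by move=> z k; rewrite metric_sym; exact: close2.
- move=> f_n_shadow eps eps_gt0; have [x0 _] := X_two_points.
  have [delta [m _ shadow]] := f_n_shadow x0 _ (half_gt0 _ eps_gt0).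
  have [delta_gt0 _] := shadow m (leqnn m).
  exists (delta / 2) => [|u u_po]; first exact: half_gt0.
  have [N1 close1] := f_orbital _ (half_gt0 _ delta_gt0).
  have [N2 close2] := f_orbital _ (half_gt0 _ eps_gt0).
  pose n := maxn m (maxn N1 N2).
  have /and3P[mn N1n N2n] : [&& (m <= n)%N, (N1 <= n)%N & (N2 <= n)%N].
    by rewrite -!geq_max.
  pose v i := if i is 0%N then x0 else u i.
  have uv i : (1 <= i)%N -> u i = v i by case: i.
  have [_ shadow_n] := shadow n mn.
  have [||y y_shadow] := shadow_n v.
  + rewrite (splitr delta).
    apply: (@ergodic_pseudo_orbit_transfer _ _ _ _ _ _ u v 1 _ uv u_po) => z.
    by rewrite metric_sym; exact: close1 N1n z 1%N.
  + by [].
  + exists y; rewrite (splitr eps).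
    apply: (@shadowed_in_average_transfer _ _ _ _ _ _ v u 1 y _ _ y_shadow).
      exact: close2.
    by move=> i /uv.
Qed.
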